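(* Let $X$ be a completely regular space and let $\mathscr{I}$ be an ideal in an upper semi-lattice $(\mathscr{L},\subseteq)$, where $\mathscr{L}\subseteq\mathscr{P}(X)$. The following are equivalent: (1) $X\subseteq\lambda_{\mathscr I} X$. (2) $X$ is locally null. (3) $C^{\mathscr I}_0(X)$ is of empty hull. (4) $C^{\mathscr I}_{00}(X)$ is of empty hull.
   Context: A space is a topological space; completely regular spaces are taken to be Hausdorff, and $\beta X$ is the Stone–Čech compactification of $X$, containing $X$ as a dense subspace. $\mathscr{P}(X)$ is the power set of $X$. $C_b(X)$ is the algebra of continuous bounded $f:X\to\mathbb{R}$; $\mathrm{coz}(f)=X\setminus f^{-1}(0)$, $\mathrm{supp}(f)=\mathrm{cl}_X\mathrm{coz}(f)$, and $\mathrm{Coz}(X)$ is the set of all cozero-sets of continuous real-valued functions on $X$. An upper semi-lattice is a partially ordered set in which any two elements $A,B$ have a least upper bound $A\vee B$. For $\mathscr{L}\subseteq\mathscr{P}(X)$ ordered by inclusion, $A\vee B$ is computed in $\mathscr{L}$ and need not equal $A\cup B$. An ideal $\mathscr{I}$ in $(\mathscr{L},\subseteq)$ is a non-empty subset of $\mathscr{L}$ such that $A\vee B\in\mathscr{I}$ whenever $A,B\in\mathscr{I}$, and $T\in\mathscr{I}$ whenever $T\in\mathscr{L}$ and $T\subseteq A$ for some $A\in\mathscr{I}$. Elements of $\mathscr{I}$ are called null. A neighborhood of a set $A$ in $X$ is a set $U\subseteq X$ with $A\subseteq\mathrm{int}_XU$. $X$ is locally null (with respect to $\mathscr{I}$)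 if every point of $X$ has a null neighborhood in $X$. $C^{\mathscr I}_{00}(X)=\{f\in C_b(X):\mathrm{supp}(f)\text{ has a null neighborhood in }X\}$. $C^{\mathscr I}_0(X)=\{f\in C_b(X):|f|^{-1}([1/n,\infty))\text{ has a null neighborhood in }X\text{ for each positive integer }n\}$. $\lambda_{\mathscr I} X=\bigcup\{\mathrm{int}_{\beta X}\mathrm{cl}_{\beta X}C: C\in\mathrm{Coz}(X)\text{ and }\mathrm{cl}_XC\text{ has a null neighborhood in }X\}$, considered as a subspace of $\beta X$. An ideal $H$ of $C_b(X)$ is of empty hull if for every $x\in X$ there is $h\in H$ with $h(x)\neq0$. *)

(* Defs.v *)
From HB Require Import structures.
From mathcomp Require Import all_boot all_order all_algebra.
From mathcomp Require Import all_classical all_reals all_analysis.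

Set Implicit Arguments.
Unset Strict Implicit.
Unset Printing Implicit Defensive.

Import Order.TTheory GRing.Theory Num.Theory.
Import numFieldNormedType.Exports.

Local Open Scope classical_set_scope.
Local Open Scope ring_scope.

(* The library's [completely_regular_space] does not include separation. *)
Definition completely_regular_hausdorff (X : topologicalType) : Prop :=
  completely_regular_space X /\ hausdorff_space X.

(* The topology of X is the one induced from Y along the injection e. *)
Definition topological_embedding (X Y : topologicalType) (e : X -> Y) : Prop :=
  injective e /\ @open X = [set e @^-1` B | B in @open Y].

Definition is_compactification (X bX : topologicalType) (e : X -> bX) : Prop :=
  [/\ compact [set: bX], hausdorff_space bX, topological_embedding e
    & dense (range e)].

(* A point x of X is identified with the point e x of bX. Uniqueness of the
   extension h is automatic, by density of the range of e. *)
Definition is_stone_cech (X bX : topologicalType) (e : X -> bX) : Prop :=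
  is_compactification e /\
  forall (K : topologicalType) (g : X -> K),
    compact [set: K] -> hausdorff_space K -> continuous g ->
    exists2 h : bX -> K, continuous h & h \o e = g.

Section null_sets.
Variable X : Type.
Implicit Types (L I : set (set X)) (A B C T : set X).

Definition is_join_in L A B C : Prop :=
  [/\ L C, A `<=` C, B `<=` C
    & forall D, L D -> A `<=` D -> B `<=` D -> C `<=` D].

Definition upper_semilattice L : Prop :=
  forall A B, L A -> L B -> exists C, is_join_in L A B C.

Definition ideal_in L I : Prop :=
  [/\ I `<=` L, I !=set0,
      (forall A B C, I A -> I B -> is_join_in L A B C -> I C)
    & forall A T, I A -> L T -> T `<=` A -> I T].

End null_sets.

Definition has_null_nbhd (X : topologicalType) (I : set (set X)) (A : set X)
  : Prop := exists2 U, I U & A `<=` U°.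

Definition locally_null (X : topologicalType) (I : set (set X)) : Prop :=
  forall x : X, has_null_nbhd I [set x].

Section function_algebras.
Variables (R : realType) (X : topologicalType).
Implicit Types (f g h : X -> R) (I : set (set X)) (H : set (X -> R)).

Definition Cb : set (X -> R) := [set f | continuous f /\ bounded_fun f].

Definition coz f : set X := [set x | f x != 0].

Definition supp f : set X := closure (coz f).

Definition Coz : set (set X) := [set coz f | f in [set f | continuous f]].

Definition C00 I : set (X -> R) :=
  [set f | Cb f /\ has_null_nbhd I (supp f)].

Definition C0 I : set (X -> R) :=
  [set f | Cb f /\ forall n : nat, (0 < n)%N ->
     has_null_nbhd I [set x | n%:R^-1 <= `|f x|]].

(* Ideals need not be proper. Stability under scalars and opposites follows
   from the last clause, since constant functions lie in Cb. *)
Definition is_ideal_Cb H : Prop :=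
  [/\ H `<=` Cb, H (cst 0), (forall f g, H f -> H g -> H (f \+ g))
    & forall h f, Cb h -> H f -> H (h \* f)].

Definition ideal_of_empty_hull H : Prop :=
  is_ideal_Cb H /\ forall x, exists2 h, H h & h x != 0.

(* Closures of subsets of X are taken in bX after transport along e. *)
Definition lambda I (bX : topologicalType) (e : X -> bX) : set bX :=
  \bigcup_(C in [set C | Coz C /\ has_null_nbhd I (closure C)])
    (closure (e @` C))°.

End function_algebras.

Arguments C00 R {X} I.
Arguments C0 R {X} I.
Arguments lambda R {X} I {bX} e.

(* Main.v *)
Require Import Defs.
From mathcomp Require Import all_boot all_order all_algebra.
From mathcomp Require Import all_classical all_reals all_analysis.
From mathcomp Require Import lra.

(** The point is that all four conditions say, in different languages, that
    each point of X can be separated from the complement of a null set.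

    - A point of lambda X that lies in X belongs to the closure, taken in the
      compactification, of some cozero-set C; the embedding being a
      homeomorphism onto its image, it already belongs to the closure of C
      in X, which has a null neighborhood ([embedding_closure],
      [locally_null_of_lambda]).
    - If x lies in the interior of a null set U, complete regularity gives a
      bounded continuous function that is 1 at x and vanishes off the interior
      of U, so all the sets where it is at least 1/n in absolute value lie in
      that interior ([C0_nonvanishing]).
    - If h in C0 satisfies |h(x)| > eps > 0, then the positive part of
      |h| - eps does not vanish at x, and its support lies in the closed set
      where |h| >= eps ([C0_truncation]).
    - If f in C00 does not vanish at x, then coz f is an open set of X, the
      trace of an open set B of the compactification; by density B lies in the
      closure of coz f, so x is an interior point of that closure
      ([open_sub_closure_trace]).

    That C0 and C00 are ideals of Cb comes from the ideal property of the null
    sets: a join of two null sets is null and contains their union, so sets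
    with null neighborhoods are closed under finite unions and subsets. *)

Set Implicit Arguments.
Unset Strict Implicit.
Unset Printing Implicit Defensive.

Import Order.TTheory GRing.Theory Num.Theory.
Import numFieldNormedType.Exports.

Local Open Scope classical_set_scope.
Local Open Scope ring_scope.

(** * Sets with a null neighborhood *)

Section null_neighborhoods.
Variables (X : topologicalType) (L I : set (set X)).
Hypotheses (hL : upper_semilattice L) (hI : ideal_in L I).
Implicit Types A B : set X.

Lemma has_null_nbhdS A B : A `<=` B -> has_null_nbhd I B -> has_null_nbhd I A.
Proof. by move=> AB [U IU BU]; exists U => // x /AB/BU. Qed.

Lemma has_null_nbhd0 : has_null_nbhd I set0.
Proof. by case: hI => _ [U IU] _ _; exists U. Qed.

(** The join of two null neighborhoods may be larger than their union, but
    being larger does no harm to a neighborhood. *)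
Lemma has_null_nbhdU A B :
  has_null_nbhd I A -> has_null_nbhd I B -> has_null_nbhd I (A `|` B).
Proof.
move=> [U IU AU] [V IV BV]; case: hI => IL _ Ijoin _.
have [W UVW] := hL (IL _ IU) (IL _ IV).
exists W; first exact: Ijoin IU IV UVW.
case: UVW => _ UW VW _ x [/AU|/BV]; exact: interiorS.
Qed.

End null_neighborhoods.

(** * The algebras C0 and C00 are ideals of bounded continuous functions *)

Section function_ideals.
Variables (R : realType) (X : topologicalType).
Implicit Types f g h : X -> R.

Lemma bounded_by_posP f :
  bounded_fun f <-> exists2 M : R, 0 < M & forall x, `|f x| <= M.
Proof.
split=> [/ex_strict_bound_gt0[M M0 fM]|[M M0 fM]].
  by exists M => // x; apply/ltW/fM.
rewrite /= /bounded_near; near=> N => x _ /=.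
apply: (le_trans (fM x)); near: N; exact: nbhs_pinfty_ge (num_real _).
Unshelve. all: by end_near. Qed.

Lemma Cb_cst0 : Cb (cst 0 : X -> R).
Proof.
split; first exact: cst_continuous.
by apply/bounded_by_posP; exists 1 => // x; rewrite normr0.
Qed.

Lemma CbD f g : Cb f -> Cb g -> Cb (f \+ g).
Proof.
move=> [cf /bounded_by_posP[M M0 fM]] [cg /bounded_by_posP[N N0 gN]]; split.
  by move=> x; apply: continuousD; [exact: cf|exact: cg].
apply/bounded_by_posP; exists (M + N); first exact: addr_gt0.
by move=> x; rewrite (le_trans (ler_normD _ _))// lerD.
Qed.

Lemma CbM f g : Cb f -> Cb g -> Cb (f \* g).
Proof.
move=> [cf /bounded_by_posP[M M0 fM]] [cg /bounded_by_posP[N N0 gN]]; split.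
  by move=> x; apply: continuousM; [exact: cf|exact: cg].
apply/bounded_by_posP; exists (M * N); first exact: mulr_gt0.
by move=> x; rewrite normrM ler_pM.
Qed.

Variable I : set (set X).

(** The levels 1/n in the definition of C0 are cofinal among the positive
    levels. *)
Lemma C0_level f (eps : R) : C0 R I f -> 0 < eps ->
  has_null_nbhd I [set x | eps <= `|f x|].
Proof.
move=> [_ fI] eps0; set n := (Num.truncn eps^-1).+1.
apply: (has_null_nbhdS _ (fI n _)) => // x /=; apply: le_trans.
by rewrite invf_ple ?posrE// ?ltr0n// ltW// truncnS_gt.
Qed.

Variables (L : set (set X)).
Hypotheses (hL : upper_semilattice L) (hI : ideal_in L I).

Lemma C0_ideal : is_ideal_Cb (C0 R I).
Proof.
split.
- by move=> f [].
- split=> [|n n0]; first exact: Cb_cst0.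
  apply: (has_null_nbhdS _ (has_null_nbhd0 hI)) => x /=.
  by rewrite normr0 invr_le0 lern0 -leqn0 leqNgt n0.
- move=> f g Cf Cg; split=> [|n n0]; first exact: CbD Cf.1 Cg.1.
  (* A sum reaches the level 1/n only where one summand reaches half of it. *)
  have lvl0 : 0 < n%:R^-1 / 2 :> R by rewrite divr_gt0// invr_gt0 ltr0n.
  apply: (has_null_nbhdS _
    (has_null_nbhdU hL hI (C0_level Cf lvl0) (C0_level Cg lvl0))).
  move=> x /= fgx; have := ler_normD (f x) (g x).
  by have [|fx] := leP (n%:R^-1 / 2) `|f x|; [left|right; lra].
- move=> h f Ch Cf; split=> [|n n0]; first exact: CbM Ch Cf.1.
  case: Ch => _ /bounded_by_posP[M M0 hM].
  have lvl0 : 0 < n%:R^-1 / M by rewrite divr_gt0// invr_gt0 ltr0n.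
  apply: (has_null_nbhdS _ (C0_level Cf lvl0)) => x /= /le_trans lehf.
  rewrite ler_pdivrMr// mulrC; apply: lehf.
  by rewrite normrM ler_wpM2r.
Qed.

Lemma C00_ideal : is_ideal_Cb (C00 R I).
Proof.
split.
- by move=> f [].
- split; first exact: Cb_cst0.
  apply: (has_null_nbhdS _ (has_null_nbhd0 hI)).
  by rewrite /supp (_ : coz _ = set0) ?closure0// -subset0 => x; rewrite /coz /= eqxx.
- move=> f g [Cf If] [Cg Ig]; split; first exact: CbD.
  apply: (has_null_nbhdS _ (has_null_nbhdU hL hI If Ig)).
  rewrite /supp -closureU; apply: closureS => x /= fgx.
  have [fx0|] := eqVneq (f x) 0; last by left.
  by right; move: fgx; rewrite /coz /= fx0 add0r.
- move=> h f Ch [Cf If]; split; first exact: CbM.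
  apply: (has_null_nbhdS _ If); apply: closureS => x; rewrite /coz /=.
  by apply: contra_neq => /= ->; rewrite mulr0.
Qed.

End function_ideals.

(** * Functions not vanishing at a given point *)

Section nonvanishing.
Variables (R : realType) (X : topologicalType) (I : set (set X)).

Lemma C0_nonvanishing (x : X) : completely_regular_space X ->
  has_null_nbhd I [set x] -> exists2 f, C0 R I f & f x != 0.
Proof.
move=> crX [U IU xU].
have /(@uniform_separatorP _ R)[f [cf f01 fx fU]] :
    uniform_separator [set x] (~` U°).
  by apply: crX; [exact/open_closedC/open_interior|apply; exact: xU].
(* The separating function is 0 at x and 1 off the interior of U; its
   complement to 1 has these values exchanged. *)
exists (fun y => 1 - f y); last first.
  by rewrite (fx (f x)) ?subr0 ?oner_eq0//; exists x.
have f01' y : 0 <= f y <= 1.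
  by have /f01 /= : range f (f y); [exists y|rewrite in_itv].
split; first split.
- by move=> y; apply: cvgB; [exact: cvg_cst|exact: cf].
- apply/bounded_by_posP; exists 1 => // y; rewrite ler_norml.
  by have /andP[f0 f1] := f01' y; apply/andP; split; lra.
move=> n n0; exists U => // y /=; apply: contraPP => yU.
have -> : f y = 1 by apply: fU; exists y.
by rewrite subrr normr0 invr_le0 lern0 -leqn0 leqNgt n0.
Qed.

Lemma supp_sub_closed (f : X -> R) (F : set X) :
  closed F -> coz f `<=` F -> supp f `<=` F.
Proof. by move=> /closure_id {2}-> fF; exact: closureS. Qed.

Lemma C0_truncation (h : X -> R) (x : X) : C0 R I h -> h x != 0 ->
  exists2 f, C00 R I f & f x != 0.
Proof.
move=> Ch hx0; pose eps := `|h x| / 2.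
have eps0 : 0 < eps by rewrite divr_gt0// normr_gt0.
have [[ch bh] _] := Ch.
have cnh : continuous (fun y => `|h y|).
  by move=> y; apply: cvg_norm; exact: ch.
exists (fun y => Num.max (`|h y| - eps) 0); last first.
  by rewrite gt_eqF// lt_max subr_gt0 ltr_pdivrMr// ltr_pMr ?normr_gt0// ltr1n.
split; first split.
- move=> y; apply: (@continuous_max R X (fun y => `|h y| - eps) (cst 0)).
    by apply: cvgB; [exact: cnh|exact: cvg_cst].
  exact: cvg_cst.
- move/bounded_by_posP : bh => [M M0 hM]; apply/bounded_by_posP; exists M => // y.
  rewrite ger0_norm ?le_max ?lexx ?orbT// ge_max (ltW M0) andbT.
  by have := hM y; lra.
apply: (has_null_nbhdS _ (C0_level Ch eps0)); apply: supp_sub_closed.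
  exact: (continuous_closedP _).1 cnh _ (@closed_ge _ eps).
move=> y /=; apply: contra_neqT; rewrite -ltNge => hy.
by apply/max_idPr; rewrite subr_le0 ltW.
Qed.

End nonvanishing.

(** * Closures along a dense embedding *)

Section dense_embedding.
Variables (X Y : topologicalType) (e : X -> Y).

Lemma embedding_closure (C : set X) (x : X) : topological_embedding e ->
  closure (e @` C) (e x) -> closure C x.
Proof.
move=> [_ openE'] eCx B; rewrite nbhsE => -[V [oV Vx] VB].
move: oV; rewrite openE' => -[W oW WV].
have /eCx[_ [[c Cc <-] Wc]] : nbhs (e x) W.
  by apply: open_nbhs_nbhs; split=> //; move: Vx; rewrite -WV.
by exists c; split=> //; apply: VB; rewrite -WV.
Qed.

Lemma open_sub_closure_trace (B : set Y) : dense (range e) -> open B ->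
  B `<=` closure (e @` (e @^-1` B)).
Proof.
move=> de oB y By N; rewrite nbhsE => -[V [oV Vy] VN].
have [||z [[Bz Vz] [x _ xz]]] := de (B `&` V).
- by exists y.
- exact: openI.
by exists z; split; [exists x; rewrite /preimage /= ?xz|exact: VN].
Qed.

End dense_embedding.

Section lambda_points.
Variables (R : realType) (X Y : topologicalType) (e : X -> Y).
Variable I : set (set X).
Hypothesis emb : topological_embedding e.

Lemma locally_null_of_lambda : range e `<=` lambda R I e -> locally_null I.
Proof.
move=> el x; have [|C [_ CI] /interior_subset Cx] := el (e x); first by exists x.
by apply: has_null_nbhdS CI => _ ->; exact: embedding_closure Cx.
Qed.

Lemma lambda_of_C00 (f : X -> R) (x : X) : dense (range e) ->
  C00 R I f -> f x != 0 -> lambda R I e (e x).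
Proof.
move=> de [[cf _] fI] fx0; exists (coz f); first by split=> //; exists f.
have : open (coz f).
  rewrite (_ : coz f = f @^-1` (~` [set 0])); last first.
    by apply/seteqP; split=> y /eqP.
  by apply: open_comp => [y _|]; [exact: cf|exact/closed_openC/closed_eq].
rewrite emb.2 => -[B oB BE].
have : B (e x) by have : (e @^-1` B) x by rewrite BE.
rewrite /interior nbhsE => Bx; exists B => //.
by rewrite -BE; exact: open_sub_closure_trace.
Qed.

End lambda_points.

(** * The equivalence *)

Local Close Scope ring_scope.

Theorem theorem3p6 (R : realType) (X : topologicalType)
    (hX : completely_regular_hausdorff X)
    (bX : topologicalType) (e : X -> bX) (hbX : is_stone_cech e)
    (L : set (set X)) (hL : upper_semilattice L)
    (I : set (set X)) (hI : ideal_in L I) :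
  [<-> range e `<=` lambda R I e;
       locally_null I;
       ideal_of_empty_hull (C0 R I);
       ideal_of_empty_hull (C00 R I)].
Proof.
have [[_ _ emb de] _] := hbX; have [crX _] := hX.
tfae.
- exact: locally_null_of_lambda.
- move=> lnI; split=> [|x]; first exact: C0_ideal hL hI.
  exact: C0_nonvanishing.
- move=> [_ C0x]; split=> [|x]; first exact: C00_ideal hL hI.
  by have [h Ch hx0] := C0x x; exact: C0_truncation Ch hx0.
- move=> [_ C00x] _ [x _ <-]; have [f Cf fx0] := C00x x.
  exact: lambda_of_C00 Cf fx0.
Qed.
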